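(* For a fuzzy function $f:\mathbb{T}\to\mathcal{F}_N(\mathbb{R})$ on a time scale $\mathbb{T}$ and a point $s\in\mathbb{T}_\kappa^\kappa$, the existence of the generalized Hukuhara nabla derivative of $f$ at $s$ does not imply the existence of the generalized Hukuhara delta derivative of $f$ at $s$, and vice versa. That is: (a) there exist a time scale $\mathbb{T}$, a function $f:\mathbb{T}\to\mathcal{F}_N(\mathbb{R})$ and a point $s\in\mathbb{T}_\kappa^\kappa$ such that $(\nabla_{gH}f)(s)$ exists but $(\Delta_{gH}f)(s)$ does not exist; and (b) there exist a time scale $\mathbb{T}$, a function $f:\mathbb{T}\to\mathcal{F}_N(\mathbb{R})$ and a point $s\in\mathbb{T}_\kappa^\kappa$ such that $(\Delta_{gH}f)(s)$ exists but $(\nabla_{gH}f)(s)$ does not exist.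
   Context: A time scale $\mathbb{T}$ is a nonempty closed subset of $\mathbb{R}$. The forward and backward jump operators are $\sigma(t)=\inf\{s\in\mathbb{T}:s>t\}$ (with $\inf\varnothing:=\sup\mathbb{T}$) and $\rho(t)=\sup\{s\in\mathbb{T}:s<t\}$ (with $\sup\varnothing:=\inf\mathbb{T}$). A point $t$ is right-scattered if $\sigma(t)>t$ and left-scattered if $\rho(t)<t$. $\mathbb{T}^\kappa$ is $\mathbb{T}$ with its maximum removed if $\mathbb{T}$ has a left-scattered maximum, and $\mathbb{T}^\kappa=\mathbb{T}$ otherwise; $\mathbb{T}_\kappa$ is $\mathbb{T}$ with its minimum removed if $\mathbb{T}$ has a right-scattered minimum, and $\mathbb{T}_\kappa=\mathbb{T}$ otherwise; $\mathbb{T}_\kappa^\kappa=\mathbb{T}^\kappa\cap\mathbb{T}_\kappa$. Write $\mu_{st}=\sigma(s)-t$ and $\nu_{st}=t-\rho(s)$. A fuzzy number is a function $u:\mathbb{R}\to[0,1]$ that is normal ($u(x_0)=1$ for some $x_0$), quasiconcave, upper semicontinuous, and has compact support $\mathrm{cl}\{x:u(x)>0\}$; $\mathcal{F}_N(\mathbb{R})$ is the set of fuzzy numbers. The $r$-level sets are $u_r=\{x:u(x)\ge r\}$ for $0<r\le1$ and $u_0=\mathrm{cl}\{x:u(x)>0\}$; they are compact intervals $u_r=[u_r^-,u_r^+]$. Addition and multiplication by real scalars are levelwise: $(u+v)_r=u_r+v_r$, $(cu)_r=c\,u_r$ (interval operations). The generalized Hukuhara difference $u\ominus_{gH}v$ is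 the fuzzy number $w$, if it exists, such that $u=v+w$ or $v=u+(-1)w$. The metric is $D_\infty(u,v)=\sup_{r\in[0,1]}\max\{|u_r^--v_r^-|,|u_r^+-v_r^+|\}$. Generalized Hukuhara delta derivative: for $s\in\mathbb{T}^\kappa$, $(\Delta_{gH}f)(s)$ is the fuzzy number, if it exists, such that for every $\epsilon>0$ there is $\delta>0$ such that for all $t\in(s-\delta,s+\delta)\cap\mathbb{T}$, $f(\sigma(s))\ominus_{gH}f(t)$ exists and $D_\infty\big(f(\sigma(s))\ominus_{gH}f(t),(\Delta_{gH}f)(s)\mu_{st}\big)\le\epsilon|\mu_{st}|$. Generalized Hukuhara nabla derivative: for $s\in\mathbb{T}_\kappa$, $(\nabla_{gH}f)(s)$ is the fuzzy number, if it exists, such that for every $\epsilon>0$ there is $\delta>0$ such that for all $t\in(s-\delta,s+\delta)\cap\mathbb{T}$, $f(t)\ominus_{gH}f(\rho(s))$ exists and $D_\infty\big(f(t)\ominus_{gH}f(\rho(s)),(\nabla_{gH}f)(s)\nu_{st}\big)\le\epsilon|\nu_{st}|$. *)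

(* Defs.v *)
From HB Require Import structures.
From mathcomp Require Import all_boot all_order all_algebra.
From mathcomp Require Import all_classical all_reals all_analysis.
From mathcomp Require Import ring lra.

Set Implicit Arguments.
Unset Strict Implicit.
Unset Printing Implicit Defensive.

Import Order.TTheory GRing.Theory Num.Theory.
Import numFieldNormedType.Exports.

Local Open Scope classical_set_scope.
Local Open Scope ring_scope.

Definition time_scale (R : realType) (T : set R) : Prop :=
  T !=set0 /\ closed T.

(* The library gives [inf set0 = sup set0 = 0], so the conventions
   inf {} := sup T and sup {} := inf T are imposed explicitly; in those cases
   a point [t] of [T] is the maximum (resp. minimum) of [T]. *)
Definition sigma (R : realType) (T : set R) (t : R) : R :=
  if `[< exists s, T s /\ t < s >] then inf [set s | T s /\ t < s] else sup T.

Definition rho (R : realType) (T : set R) (t : R) : R :=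
  if `[< exists s, T s /\ s < t >] then sup [set s | T s /\ s < t] else inf T.

Definition right_scattered (R : realType) (T : set R) (t : R) : Prop :=
  t < sigma T t.

Definition left_scattered (R : realType) (T : set R) (t : R) : Prop :=
  rho T t < t.

Definition kappa_up (R : realType) (T : set R) : set R :=
  [set t | T t /\ ~ (ubound T t /\ left_scattered T t)].

Definition kappa_down (R : realType) (T : set R) : set R :=
  [set t | T t /\ ~ (lbound T t /\ right_scattered T t)].

Definition kappa_both (R : realType) (T : set R) : set R :=
  kappa_up T `&` kappa_down T.

Record fuzzy (R : realType) := Fuzzy {
  fuzzy_fun :> R -> R ;
  fuzzy_ge0 : forall x, 0 <= fuzzy_fun x ;
  fuzzy_le1 : forall x, fuzzy_fun x <= 1 ;
  fuzzy_normal : exists x, fuzzy_fun x = 1 ;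
  fuzzy_quasiconcave : forall x y t, 0 <= t <= 1 ->
    Num.min (fuzzy_fun x) (fuzzy_fun y) <= fuzzy_fun (t * x + (1 - t) * y) ;
  fuzzy_usc : forall x a, fuzzy_fun x < a -> \forall y \near x, fuzzy_fun y < a ;
  fuzzy_compact_support : compact (closure [set x | 0 < fuzzy_fun x]) }.

(* Only meaningful for [0 <= r <= 1]. *)
Definition level (R : realType) (u : fuzzy R) (r : R) : set R :=
  if r == 0 then closure [set x | 0 < u x] else [set x | r <= u x].

Definition lo (R : realType) (u : fuzzy R) (r : R) : R := inf (level u r).
Definition hi (R : realType) (u : fuzzy R) (r : R) : R := sup (level u r).

Lemma fuzzy_ext (R : realType) (u v : fuzzy R) : u =1 v -> u = v.
Proof.
case: u v => [u u1 u2 u3 u4 u5 u6] [v v1 v2 v3 v4 v5 v6] /= uv.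
have E : u = v by apply/funext.
subst v.
by congr Fuzzy; exact: Prop_irrelevance.
Qed.

Lemma level_pos (R : realType) (u : fuzzy R) (r x : R) :
  0 < r -> level u r x <-> r <= u x.
Proof. by move=> r0; rewrite /level gt_eqF. Qed.

Lemma level_inj (R : realType) (u v : fuzzy R) :
  (forall r, 0 <= r <= 1 -> level u r = level v r) -> u = v.
Proof.
move=> uv; apply: fuzzy_ext => x; apply/eqP; rewrite eq_le.
suff H : forall u v : fuzzy R,
    (forall r, 0 <= r <= 1 -> level u r = level v r) -> u x <= v x.
  by rewrite !H// => r /uv.
move=> {uv} {}u {}v uv.
have := fuzzy_ge0 u x; rewrite le_eqVlt => /orP[/eqP <-|u0].
  exact: fuzzy_ge0.
apply/(level_pos _ _ u0); rewrite -uv; first exact/(level_pos _ _ u0).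
by rewrite (ltW u0) fuzzy_le1.
Qed.

Lemma level_nonempty (R : realType) (u : fuzzy R) (r : R) :
  0 <= r <= 1 -> level u r !=set0.
Proof.
move=> /andP[r0 r1]; have [x ux] := fuzzy_normal u; exists x.
rewrite /level; case: eqP => _ /=; last by rewrite ux.
by apply: subset_closure => /=; rewrite ux.
Qed.

Lemma level_decr (R : realType) (u : fuzzy R) (r s : R) :
  0 <= r -> r <= s -> level u s `<=` level u r.
Proof.
move=> r0 rs x; rewrite /level; case: (eqVneq r 0) => [re|rn].
  case: (eqVneq s 0) => // sn sx; apply: subset_closure => /=.
  by apply: lt_le_trans sx; rewrite lt_neqAle eq_sym sn (le_trans r0 rs).
have s0 : 0 < s by apply: lt_le_trans rs; rewrite lt_neqAle eq_sym rn.
by rewrite gt_eqF//= => /(le_trans rs).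
Qed.

Lemma level_closed (R : realType) (u : fuzzy R) (r : R) : closed (level u r).
Proof.
rewrite /level; case: eqP => _; first exact: closed_closure.
rewrite -[X in closed X]setCK; apply: open_closedC.
rewrite openE => x /= /negP; rewrite -ltNge => /(fuzzy_usc (f:=u)) H.
by rewrite /interior; near=> y; apply/negP; rewrite -ltNge; near: y.
Unshelve. all: by end_near. Qed.

Lemma level_compact (R : realType) (u : fuzzy R) (r : R) :
  0 <= r -> compact (level u r).
Proof.
move=> r0; apply: (@subclosed_compact _ _ (level u 0)).
- exact: level_closed.
- by rewrite /level eqxx; exact: fuzzy_compact_support.
- exact: level_decr.
Qed.

Lemma closure_is_interval (R : realType) (A : set R) :
  is_interval A -> is_interval (closure A).
Proof.
move=> Ai; apply/is_intervalPlt => x y cx cy z /andP[xz zy].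
have [a [Aa /= az]] := cx _ (lt_nbhsl xz).
have [b [Ab /= zb]] := cy _ (lt_nbhsr zy).
by apply: subset_closure; apply: (Ai _ _ Aa Ab); rewrite !ltW.
Qed.

Lemma convex_combP (R : realType) (x y z : R) : x <= z <= y ->
  exists2 t, 0 <= t <= 1 & z = t * x + (1 - t) * y.
Proof.
move=> /andP[xz zy]; have [xy|xy] := eqVneq x y.
  by exists 0; [lra|lra].
have xy' : 0 < y - x by rewrite subr_gt0 lt_neqAle xy (le_trans xz).
exists ((y - z) / (y - x)); last by field; exact: lt0r_neq0.
rewrite divr_ge0 ?ler_pdivrMr//=; lra.
Qed.

Lemma level_interval (R : realType) (u : fuzzy R) (r : R) :
  is_interval (level u r).
Proof.
have H x y z : x <= z <= y -> Num.min (u x) (u y) <= u z.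
  by move=> /convex_combP[t t01 ->]; exact: fuzzy_quasiconcave.
rewrite /level; case: eqP => _.
  apply: closure_is_interval => x y /= x0 y0 z /H; apply: lt_le_trans.
  by rewrite lt_min x0.
by move=> x y /= x0 y0 z /H; apply: le_trans; rewrite le_min x0.
Qed.

Lemma compact_inf (R : realType) (A : set R) :
  A !=set0 -> compact A -> has_inf A /\ A (inf A).
Proof.
move=> A0 cA; have [M [_ MA]] := compact_bounded cA.
have hA : has_inf A.
  split=> //; exists (- (M + 1)) => x Ax.
  have M1 : M < M + 1 by rewrite ltrDl.
  by have /= := MA _ M1 x Ax; rewrite ler_norml => /andP[].
have cl : closed A by exact: (compact_closed (@Rhausdorff R) cA).
split=> //; suff : closure A (inf A) by rewrite -(closure_id A).1.
move=> B /nbhs_ballP[e /= e0 eB]; have [x Ax xlt] := inf_adherent e0 hA.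
exists x; split=> //; apply: eB; rewrite /ball/= distrC ger0_norm; first lra.
by rewrite subr_ge0 ge_inf//; case: hA.
Qed.

Lemma level_itv (R : realType) (u : fuzzy R) (r : R) :
  0 <= r <= 1 -> level u r = `[lo u r, hi u r]%classic.
Proof.
move=> r01; have r0 : 0 <= r by case/andP: r01.
have n0 := level_nonempty u r01; have cp := level_compact (u:=u) r0.
have cl := level_closed (u:=u) (r:=r); have [_ hs] := compact_has_sup n0 cp.
have [[_ hl] Ll] := compact_inf n0 cp.
have Lh : level u r (hi u r) by rewrite [level u r](closure_id _).1//; exact: closure_sup.
apply/seteqP; split=> x /=; rewrite in_itv/=; last exact: (level_interval Ll Lh).
by move=> Lx; rewrite ge_inf// ub_le_sup.
Qed.

Lemma lo_le_hi (R : realType) (u : fuzzy R) (r : R) :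
  0 <= r <= 1 -> lo u r <= hi u r.
Proof.
move=> r01; have [x] := level_nonempty u r01.
by rewrite level_itv//= in_itv/= => /andP[]; exact: le_trans.
Qed.

Lemma lo_hi_mono (R : realType) (u : fuzzy R) (r s : R) :
  0 <= r -> r <= s -> s <= 1 -> lo u r <= lo u s /\ hi u s <= hi u r.
Proof.
move=> r0 rs s1; have := @level_decr _ u _ _ r0 rs.
have s01 : 0 <= s <= 1 by rewrite s1 (le_trans r0).
rewrite !level_itv// ?r0 ?(le_trans rs)// => H; have lh := lo_le_hi u s01.
by have := H (lo u s); have := H (hi u s); rewrite /= !in_itv/= !lexx lh/=;
  move=> /(_ isT) /andP[_ ->] /(_ isT) /andP[->].
Qed.

Lemma lo_leftcont (R : realType) (u : fuzzy R) (r e : R) :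
  0 < r <= 1 -> 0 < e -> exists2 s, 0 < s < r & lo u r - e <= lo u s.
Proof.
move=> /andP[r0 r1] e0.
have nL : ~ level u r (lo u r - e).
  by rewrite level_itv ?(ltW r0)//= in_itv/= => /andP[]; lra.
have ur : u (lo u r - e) < r by rewrite ltNge; apply/negP => /(level_pos u _ r0).
have u0 := fuzzy_ge0 u (lo u r - e).
pose s := (u (lo u r - e) + r) / 2.
have s0 : 0 < s by rewrite /s; lra.
have sr : s < r by rewrite /s; lra.
have us : u (lo u r - e) < s by rewrite /s; lra.
exists s; first by rewrite s0.
rewrite leNgt; apply/negP => lt.
have : level u s (lo u r - e).
  have [_ h] := lo_hi_mono u (ltW s0) (ltW sr) r1.
  have lh : lo u r <= hi u r by apply: lo_le_hi; rewrite (ltW r0).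
  rewrite level_itv ?(ltW s0) ?(le_trans (ltW sr))//= in_itv/= (ltW lt)/=; lra.
by move/(level_pos u _ s0); rewrite leNgt us.
Qed.

Lemma hi_leftcont (R : realType) (u : fuzzy R) (r e : R) :
  0 < r <= 1 -> 0 < e -> exists2 s, 0 < s < r & hi u s <= hi u r + e.
Proof.
move=> /andP[r0 r1] e0.
have nL : ~ level u r (hi u r + e).
  by rewrite level_itv ?(ltW r0)//= in_itv/= => /andP[]; lra.
have ur : u (hi u r + e) < r by rewrite ltNge; apply/negP => /(level_pos u _ r0).
have u0 := fuzzy_ge0 u (hi u r + e).
pose s := (u (hi u r + e) + r) / 2.
have s0 : 0 < s by rewrite /s; lra.
have sr : s < r by rewrite /s; lra.
have us : u (hi u r + e) < s by rewrite /s; lra.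
exists s; first by rewrite s0.
rewrite leNgt; apply/negP => lt.
have : level u s (hi u r + e).
  have [h _] := lo_hi_mono u (ltW s0) (ltW sr) r1.
  have lh : lo u r <= hi u r by apply: lo_le_hi; rewrite (ltW r0).
  rewrite level_itv ?(ltW s0) ?(le_trans (ltW sr))//= in_itv/= (ltW lt) andbT; lra.
by move/(level_pos u _ s0); rewrite leNgt us.
Qed.

(* The stacking theorem: the conditions under which a family of sets is the
   family of levels of a fuzzy number. *)
Lemma fuzzy_of_levels (R : realType) (L : R -> set R) :
  (forall r, 0 <= r <= 1 -> L r !=set0) ->
  (forall r, 0 <= r <= 1 -> compact (L r)) ->
  (forall r, 0 <= r <= 1 -> is_interval (L r)) ->
  (forall r s, 0 <= r -> r <= s -> s <= 1 -> L s `<=` L r) ->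
  (forall r x, 0 < r <= 1 -> (forall s, 0 < s < r -> L s x) -> L r x) ->
  L 0 `<=` closure [set x | exists2 r, 0 < r <= 1 & L r x] ->
  exists w : fuzzy R, forall r, 0 <= r <= 1 -> level w r = L r.
Proof.
move=> Ln Lc Li Ld Lleft L0.
pose S x := [set r | 0 <= r <= 1 /\ (r = 0 \/ L r x)].
pose w x := sup (S x).
have S0 x : S x 0 by split; [lra|left].
have Sub x : has_ubound (S x) by exists 1 => r [/andP[]].
have w0 x : 0 <= w x by exact: ub_le_sup.
have w1 x : w x <= 1 by apply: ge_sup; [exists 0|move=> r [/andP[]]].
have wL r x : 0 < r <= 1 -> (r <= w x) <-> L r x.
  move=> /andP[r0 r1]; split=> [rw|Lx]; last first.
    by apply: ub_le_sup => //; split; [rewrite (ltW r0)|right].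
  apply: Lleft => [|s /andP[s0 sr]]; first by rewrite r0.
  have hs : has_sup (S x) by split=> //; exists 0.
  have ws : 0 < w x - s by rewrite subr_gt0 (lt_le_trans sr).
  have [q [/andP[q0 q1] [->|Lq]]] := sup_adherent ws hs.
    by rewrite -/(w x); lra.
  by rewrite -/(w x) => sq; apply: Ld Lq => //; lra.
have pos : [set x | 0 < w x] = [set x | exists2 r, 0 < r <= 1 & L r x].
  apply/seteqP; split=> x /=.
    by move=> wx; exists (w x); [rewrite wx w1|apply/wL; rewrite ?wx ?w1].
  by move=> [r r01 /(wL _ _ r01)]; case/andP: r01 => + _; exact: lt_le_trans.
have hausR : hausdorff_space R by exact: (@Rhausdorff R).
have E0 : closure [set x | 0 < w x] = L 0.
  rewrite pos; apply/seteqP; split => //.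
  have cL0 : closed (L 0) by apply: compact_closed => //; apply: Lc; lra.
  rewrite [L 0](closure_id _).1//; apply: closureS => x /= [r /andP[r0 r1]].
  by apply: Ld => //; exact: ltW.
have norm : exists x, w x = 1.
  have [|x Lx] := Ln 1; first lra.
  by exists x; apply/eqP; rewrite eq_le w1/=; apply/wL => //; lra.
have qc x y t : 0 <= t <= 1 -> Num.min (w x) (w y) <= w (t * x + (1 - t) * y).
  move=> t01; set m := Num.min _ _.
  have /orP[/eqP <-|m0] : (0 == m) || (0 < m) by rewrite -le_eqVlt le_min !w0.
    exact: w0.
  have m01 : 0 < m <= 1 by rewrite m0 ge_min w1.
  have mx : m <= w x by rewrite ge_min lexx.
  have my : m <= w y by rewrite ge_min lexx orbT.
  have m01' : 0 <= m <= 1 by case/andP: m01 => /ltW -> ->.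
  apply/wL => //; have [xy|yx] := leP x y.
    apply: (Li _ m01' x y); [exact/wL|exact/wL|nra].
  apply: (Li _ m01' y x); [exact/wL|exact/wL|nra].
have usc x a : w x < a -> \forall y \near x, w y < a.
  move=> wa; have a0 : 0 < a by exact: le_lt_trans wa.
  have [a1|a1] := ltP 1 a.
    by near=> y; exact: le_lt_trans a1.
  have a01 : 0 < a <= 1 by rewrite a0.
  have cLa : closed (L a) by apply: compact_closed => //; apply: Lc; rewrite (ltW a0).
  have nLx : (~` L a) x by move=> /(wL _ _ a01); rewrite leNgt wa.
  have := closed_openC cLa; rewrite openE => /(_ _ nLx); rewrite /interior.
  apply: filterS => y nLy; rewrite ltNge; apply/negP => /(wL _ _ a01); exact: nLy.
have csupp : compact (closure [set x | 0 < w x]) by rewrite E0; apply: Lc; lra.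
exists (Fuzzy w0 w1 norm qc usc csupp) => r /andP[r0 r1].
rewrite /level /=; case: eqVneq => [->//|rn].
apply/seteqP; split=> x /=; move/wL; apply;
  by rewrite r1 andbT lt_neqAle eq_sym rn.
Unshelve. all: by end_near. Qed.

Lemma itv_addE (R : realType) (a b c d : R) : a <= b -> c <= d ->
  [set x + y | x in `[a, b] & y in `[c, d]] = `[a + c, b + d]%classic.
Proof.
move=> ab cd; apply/seteqP; split=> z /=.
  by move=> [x + [y + <-]]; rewrite /= !in_itv/=; lra.
rewrite in_itv/= => /andP[zl zu]; have [zc|zc] := leP z (a + d).
  exists a; rewrite ?in_itv/= ?lexx//; exists (z - a); last by ring.
  by rewrite in_itv/=; lra.
exists (z - d); first by rewrite /= in_itv/=; lra.
by exists d; [rewrite /= in_itv/= lexx cd|ring].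
Qed.

Lemma fuzzy_add_ex (R : realType) (u v : fuzzy R) :
  exists w : fuzzy R, forall r, 0 <= r <= 1 ->
    level w r = [set x + y | x in level u r & y in level v r].
Proof.
pose L r := [set x + y | x in level u r & y in level v r].
have LE r : 0 <= r <= 1 -> L r = `[lo u r + lo v r, hi u r + hi v r]%classic.
  by move=> r01; rewrite /L !level_itv// itv_addE// lo_le_hi.
apply: (@fuzzy_of_levels _ L).
- move=> r r01; rewrite LE//; exists (lo u r + lo v r).
  by rewrite /= in_itv/= lexx lerD ?lo_le_hi.
- by move=> r r01; rewrite LE//; exact: segment_compact.
- by move=> r r01; rewrite LE//; exact: interval_is_interval.
- move=> r s r0 rs s1 z [x Lx [y Ly <-]].
  by exists x; [exact: level_decr Lx|exists y => //; exact: level_decr Ly].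
- move=> r x r01 H; have r01' : 0 <= r <= 1 by case/andP: r01 => /ltW ->.
  rewrite LE//= in_itv/=; case/andP: (r01) => r0 r1.
  have mon w s t : 0 < s < r -> 0 < t < r ->
      lo w s <= lo w (Num.max s t) /\ hi w (Num.max s t) <= hi w s.
    move=> /andP[s0 sr] /andP[t0 tr]; apply: lo_hi_mono; first exact: ltW.
      by rewrite le_max lexx.
    by rewrite ge_max !ltW//; apply: lt_le_trans r1.
  have Hm s t : 0 < s < r -> 0 < t < r ->
      lo u (Num.max s t) + lo v (Num.max s t) <= x
        <= hi u (Num.max s t) + hi v (Num.max s t).
    move=> /andP[s0 sr] /andP[t0 tr].
    have m : 0 < Num.max s t < r by rewrite lt_max s0 gt_max sr.
    by have := H _ m; rewrite LE/= ?in_itv//=; lra.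
  apply/andP; split.
  + apply/ler_addgt0Pr => e e0; have e2 : 0 < e / 2 by lra.
    have [s sr us] := lo_leftcont u r01 e2; have [t tr vt] := lo_leftcont v r01 e2.
    have /andP[h _] := Hm _ _ sr tr; have [h1 _] := mon u _ _ sr tr.
    by have [h2 _] := mon v _ _ tr sr; rewrite maxC in h2; lra.
  + apply/ler_addgt0Pr => e e0; have e2 : 0 < e / 2 by lra.
    have [s sr us] := hi_leftcont u r01 e2; have [t tr vt] := hi_leftcont v r01 e2.
    have /andP[_ h] := Hm _ _ sr tr; have [_ h1] := mon u _ _ sr tr.
    by have [_ h2] := mon v _ _ tr sr; rewrite maxC in h2; lra.
- move=> z [x Lx [y Ly <-]] B /nbhs_ballP[e /= e0 eB].
  move: Lx Ly; rewrite /level eqxx => Lx Ly.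
  have e2 : 0 < e / 2 by rewrite divr_gt0.
  have [x' [/= ux' xx']] := Lx _ (nbhsx_ballx x _ e2).
  have [y' [/= vy' yy']] := Ly _ (nbhsx_ballx y _ e2).
  exists (x' + y'); split => /=.
    have m0 : 0 < Num.min (u x') (v y') by rewrite lt_min ux'.
    exists (Num.min (u x') (v y')); first by rewrite m0 ge_min fuzzy_le1.
    by exists x'; [apply/level_pos => //; rewrite ge_min lexx
                  |exists y' => //; apply/level_pos => //; rewrite ge_min lexx orbT].
  apply: eB; move: xx' yy'; rewrite /ball/= => xx' yy'.
  rewrite (_ : _ - _ = (x - x') + (y - y')); last by ring.
  by apply: le_lt_trans (ler_normD _ _) _; lra.
Qed.

Lemma fuzzy_scale_ex (R : realType) (c : R) (u : fuzzy R) :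
  exists w : fuzzy R, forall r, 0 <= r <= 1 ->
    level w r = [set c * x | x in level u r].
Proof.
apply: (@fuzzy_of_levels _ (fun r => [set c * x | x in level u r])).
- by move=> r r01; have [x Lx] := level_nonempty u r01; exists (c * x), x.
- move=> r /andP[r0 _]; apply: continuous_compact; last exact: level_compact.
  by apply: continuous_subspaceT; exact: mulrl_continuous.
- move=> r r01 _ _ [x Lx <-] [y Ly <-] z zi.
  have [t /andP[t0 t1] ->] := convex_combP zi.
  exists (t * x + (1 - t) * y); last by ring.
  have [xy|yx] := leP x y.
    by apply: (level_interval Lx Ly); nra.
  by apply: (level_interval Ly Lx); nra.
- by move=> r s r0 rs s1 z [x Lx <-]; exists x => //; exact: level_decr Lx.
- move=> r z /andP[r0 r1] H; have [c0|c0] := eqVneq c 0.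
    have [|x Lx] := @level_nonempty _ u r; first by rewrite (ltW r0).
    exists x => //; have [|y _ <-] := H (r / 2); first by lra.
    by rewrite c0 !mul0r.
  exists (z / c); last by field.
  apply/level_pos => //; rewrite leNgt; apply/negP => ur.
  have u0 := fuzzy_ge0 u (z / c); pose s := (u (z / c) + r) / 2.
  have s0 : 0 < s by rewrite /s; lra.
  have [|y Ly zE] := H s; first by rewrite s0 /s; lra.
  have : u (z / c) < s by rewrite /s; lra.
  by apply/negP; rewrite -leNgt -zE mulrC mulKf//; apply/(level_pos u _ s0).
- move=> _ [x Lx <-] B cB; move: Lx; rewrite /level eqxx.
  move=> /(_ _ (@mulrl_continuous _ c x _ cB))[y [/= uy By]].
  exists (c * y); split=> //; exists (u y); first by rewrite uy fuzzy_le1.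
  by exists y => //; apply/level_pos.
Qed.

(* A fuzzy number is determined by its levels ([level_inj]), so the levelwise
   equations [level_add] and [level_scale] characterize these operations. *)
Definition fuzzy_add (R : realType) (u v : fuzzy R) : fuzzy R :=
  sval (cid (fuzzy_add_ex u v)).

Lemma level_add (R : realType) (u v : fuzzy R) (r : R) : 0 <= r <= 1 ->
  level (fuzzy_add u v) r = [set x + y | x in level u r & y in level v r].
Proof. exact: (svalP (cid (fuzzy_add_ex u v))). Qed.

Definition fuzzy_scale (R : realType) (c : R) (u : fuzzy R) : fuzzy R :=
  sval (cid (fuzzy_scale_ex c u)).

Lemma level_scale (R : realType) (c : R) (u : fuzzy R) (r : R) : 0 <= r <= 1 ->
  level (fuzzy_scale c u) r = [set c * x | x in level u r].
Proof. exact: (svalP (cid (fuzzy_scale_ex c u))). Qed.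

Definition is_gH_diff (R : realType) (u v w : fuzzy R) : Prop :=
  u = fuzzy_add v w \/ v = fuzzy_add u (fuzzy_scale (-1) w).

(* A real supremum: the set is nonempty and bounded ([Dinfty_has_sup]). *)
Definition Dinfty (R : realType) (u v : fuzzy R) : R :=
  sup [set Num.max `|lo u r - lo v r| `|hi u r - hi v r| | r in `[0, 1]].

Lemma Dinfty_has_sup (R : realType) (u v : fuzzy R) :
  has_sup [set Num.max `|lo u r - lo v r| `|hi u r - hi v r| | r in `[0, 1]].
Proof.
split.
  by exists (Num.max `|lo u 0 - lo v 0| `|hi u 0 - hi v 0|), 0 => //=;
    rewrite in_itv/= lexx ler01.
pose M (w : fuzzy R) := `|lo w 0| + `|hi w 0|.
exists (M u + M v) => _ [r /= + <-]; rewrite in_itv/= => r01.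
have B (w : fuzzy R) : - M w <= lo w r /\ hi w r <= M w /\ lo w r <= hi w r.
  have /andP[r0 r1] := r01; have [h1 h2] := lo_hi_mono w (lexx 0) r0 r1.
  have h3 := lo_le_hi w r01; rewrite /M.
  have := ler_norm (- lo w 0); have := ler_norm (hi w 0); rewrite normrN.
  by have := normr_ge0 (lo w 0); have := normr_ge0 (hi w 0); lra.
have [h1 [h2 h3]] := B u; have [h4 [h5 h6]] := B v.
by rewrite ge_max !ler_norml; lra.
Qed.

(* The fuzzy function is total on the line; the two predicates below only
   inspect its values on the time scale [T] (where [t], [s], [sigma T s] and
   [rho T s] all lie). *)
Definition is_delta_gH (R : realType) (T : set R) (f : R -> fuzzy R) (s : R)
    (L : fuzzy R) : Prop :=
  forall e : R, 0 < e -> exists2 d : R, 0 < d &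
    forall t, T t -> s - d < t < s + d ->
      exists2 w, is_gH_diff (f (sigma T s)) (f t) w &
        Dinfty w (fuzzy_scale (sigma T s - t) L) <= e * `|sigma T s - t|.

Definition is_nabla_gH (R : realType) (T : set R) (f : R -> fuzzy R) (s : R)
    (L : fuzzy R) : Prop :=
  forall e : R, 0 < e -> exists2 d : R, 0 < d &
    forall t, T t -> s - d < t < s + d ->
      exists2 w, is_gH_diff (f t) (f (rho T s)) w &
        Dinfty w (fuzzy_scale (t - rho T s) L) <= e * `|t - rho T s|.

(* Main.v *)
Require Import Defs.
From HB Require Import structures.
From mathcomp Require Import all_boot all_order all_algebra.
From mathcomp Require Import all_classical all_reals all_analysis.
From mathcomp Require Import lra.

(** At an isolated point [s] of a time scale with [rho s < s < sigma s], the
limits in both definitions of derivative degenerate: the only competitor near [s] is [s]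
itself, so the delta derivative exists exactly when [f (sigma s)] and [f s] have a generalized
Hukuhara difference, and the nabla derivative exists exactly when [f s] and
[f (rho s)] have one. These are independent conditions, because the difference
of two fuzzy numbers need not exist: by [gH_diff_width], if [u] and [v] have a
difference, then one of them has at every level a width at least that of the
other. The crisp interval [0, 1] and the fuzzy number with levels
[0, 2 (1 - r)] violate this, the second being the wider at level 0 and the
narrower at level 1.

Both examples live at the point 1 of the time scale {0, 1, 2}. The function
takes equal values on one side of 1, where the difference is zero, and the
incomparable pair of values on the other side. *)

Set Implicit Arguments.
Unset Strict Implicit.
Unset Printing Implicit Defensive.

Import Order.TTheory GRing.Theory Num.Theory.
Import numFieldNormedType.Exports.

Local Open Scope classical_set_scope.
Local Open Scope ring_scope.

Definition width (R : realType) (u : fuzzy R) (r : R) : R := hi u r - lo u r.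

Lemma lo_hi_itv (R : realType) (u : fuzzy R) (r a b : R) :
  a <= b -> level u r = `[a, b]%classic -> lo u r = a /\ hi u r = b.
Proof. by move=> ab uE; rewrite /lo /hi uE inf_itv// sup_itv. Qed.

Lemma width_add (R : realType) (u v : fuzzy R) (r : R) : 0 <= r <= 1 ->
  width (fuzzy_add u v) r = width u r + width v r.
Proof.
move=> r01; have lu := lo_le_hi u r01; have lv := lo_le_hi v r01.
have [] := @lo_hi_itv _ (fuzzy_add u v) r (lo u r + lo v r) (hi u r + hi v r).
- exact: lerD.
- by rewrite level_add// !level_itv// itv_addE.
- by rewrite /width => -> ->; lra.
Qed.

Lemma width_ge0 (R : realType) (u : fuzzy R) (r : R) :
  0 <= r <= 1 -> 0 <= width u r.
Proof. by move=> r01; rewrite subr_ge0 lo_le_hi. Qed.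

(** Adding a fuzzy number never narrows a level, and each of the two cases in
the definition of the difference exhibits one operand as a sum containing the
other; the same case holds at all levels at once. *)
Lemma gH_diff_width (R : realType) (u v w : fuzzy R) : is_gH_diff u v w ->
  (forall r, 0 <= r <= 1 -> width v r <= width u r) \/
  (forall r, 0 <= r <= 1 -> width u r <= width v r).
Proof.
by case=> ->; [left|right] => r r01; rewrite width_add// lerDl width_ge0.
Qed.

(** The top level has width [a] and [b] is the spread added towards level 0, so
that the widths at levels 0 and 1 can be prescribed almost independently. *)
Lemma trapezoid_ex (R : realType) (a b : R) : 0 <= a -> 0 <= b ->
  exists u : fuzzy R, forall r, 0 <= r <= 1 ->
    level u r = `[0, a + b * (1 - r)]%classic.
Proof.
move=> a0 b0; apply: (@fuzzy_of_levels _ (fun r => `[0, a + b * (1 - r)]%classic)).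
- by move=> r /andP[r0 r1]; exists 0; rewrite /= in_itv/=; nra.
- by move=> r _; exact: segment_compact.
- by move=> r _; exact: interval_is_interval.
- by move=> r s r0 rs s1 x; rewrite /= !in_itv/= => /andP[-> /=]; nra.
- move=> r x /andP[r0 r1] H; rewrite /= in_itv/=.
  have x0 : 0 <= x by have := H (r / 2); rewrite /= in_itv/= => /(_ ltac:(lra))/andP[].
  rewrite x0/= leNgt; apply/negP => xlt.
  (* Were [x] beyond the right endpoint at level [r], it would be so already at
     a level [r - d] with [b * d] less than the excess; [d] also stays below
     [r] to keep that level positive. *)
  pose g := x - (a + b * (1 - r)).
  have g0 : 0 < g by rewrite /g; lra.
  pose d := Num.min (r / 2) (g / (2 * (b + 1))).
  have b1 : 0 < 2 * (b + 1) by lra.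
  have d0 : 0 < d by rewrite lt_min !divr_gt0.
  have dr : d <= r / 2 by rewrite ge_min lexx.
  have dg : d * (2 * (b + 1)) <= g by rewrite -ler_pdivlMr// ge_min lexx orbT.
  have := H (r - d); rewrite /= in_itv/= => /(_ ltac:(lra))/andP[_].
  by rewrite /g in dg g0; nra.
- move=> x; rewrite /= in_itv/= => /andP[x0 xab] B /nbhs_ballP[e /= e0 eB].
  (* Scaling [x] by [1 - r] moves it into level [r]; the displacement is
     [r * x], which is below [e] for this [r]. *)
  pose r := e / (e + x + 1).
  have den : 0 < e + x + 1 by lra.
  have rE : r * (e + x + 1) = e by rewrite /r divfK// gt_eqF.
  have r0 : 0 < r by rewrite divr_gt0.
  have r1 : r <= 1 by rewrite ler_pdivrMr//; lra.
  exists ((1 - r) * x); split => /=.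
    by exists r; rewrite ?r0//= in_itv/=; nra.
  by apply: eB; rewrite /ball/= ger0_norm; nra.
Qed.

Lemma width_trapezoid (R : realType) (a b : R) (u : fuzzy R) (r : R) :
  0 <= a -> 0 <= b -> 0 <= r <= 1 ->
  level u r = `[0, a + b * (1 - r)]%classic -> width u r = a + b * (1 - r).
Proof.
move=> a0 b0 /andP[r0 r1] /lo_hi_itv[]; first by nra.
by rewrite /width => -> ->; rewrite subr0.
Qed.

Lemma no_gH_diff_ex (R : realType) :
  exists u v : fuzzy R, ~ exists w, is_gH_diff v u w.
Proof.
have [u uE] := trapezoid_ex (@ler01 R) (lexx 0).
have [v vE] := trapezoid_ex (lexx 0) (@ler0n R 2).
have I0 : 0 <= (0 : R) <= 1 by lra.
have I1 : 0 <= (1 : R) <= 1 by lra.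
exists u, v => -[w /gH_diff_width[/(_ 1 I1)|/(_ 0 I0)]];
  rewrite !(width_trapezoid _ _ _ (uE _ _), width_trapezoid _ _ _ (vE _ _))//; lra.
Qed.

Lemma gH_diff_self (R : realType) (u : fuzzy R) :
  is_gH_diff u u (fuzzy_scale 0 u).
Proof.
left; apply: level_inj => r r01; rewrite level_add//; apply/seteqP; split=> x /=.
  move=> ux; exists x => //; exists 0; last by rewrite addr0.
  by rewrite level_scale//; exists x => //; rewrite mul0r.
by move=> [y uy [z]]; rewrite level_scale// => -[? _ <-]; rewrite mul0r addr0 => <-.
Qed.

Lemma fuzzy_scaleVK (R : realType) (c : R) (u : fuzzy R) :
  c != 0 -> fuzzy_scale c (fuzzy_scale c^-1 u) = u.
Proof.
move=> c0; apply: level_inj => r r01; rewrite !level_scale// image_comp.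
rewrite -[RHS]image_id; apply: eq_imagel => x _ /=.
by rewrite mulrA mulfV// mul1r.
Qed.

Lemma Dinfty_refl (R : realType) (u : fuzzy R) : Dinfty u u = 0.
Proof.
rewrite /Dinfty (_ : [set _ | _ in _] = [set 0]) ?sup1//.
apply/seteqP; split=> x /=; first by move=> [r _ <-]; rewrite !subrr normr0 maxxx.
move=> ->; exists 0; first by rewrite /= in_itv/= lexx ler01.
by rewrite !subrr normr0 maxxx.
Qed.

(** The definition tests every [t] near [s], including [t = s] itself, whatever
the tolerance. *)
Lemma delta_gH_diff (R : realType) (T : set R) (f : R -> fuzzy R) (s : R) :
  T s -> (exists L, is_delta_gH T f s L) ->
  exists w, is_gH_diff (f (sigma T s)) (f s) w.
Proof.
move=> Ts [L /(_ 1 ltr01)[d d0 /(_ s Ts)]].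
by case=> [|w fw _]; [lra|exists w].
Qed.

Lemma nabla_gH_diff (R : realType) (T : set R) (f : R -> fuzzy R) (s : R) :
  T s -> (exists L, is_nabla_gH T f s L) ->
  exists w, is_gH_diff (f s) (f (rho T s)) w.
Proof.
move=> Ts [L /(_ 1 ltr01)[d d0 /(_ s Ts)]].
by case=> [|w fw _]; [lra|exists w].
Qed.

(** The derivative is the difference quotient, with no error at all: isolation
leaves [t = s] as the only point to test. *)
Lemma delta_gH_isolated (R : realType) (T : set R) (f : R -> fuzzy R)
    (s d : R) (w : fuzzy R) :
  0 < d -> (forall t, T t -> s - d < t < s + d -> t = s) ->
  sigma T s != s -> is_gH_diff (f (sigma T s)) (f s) w ->
  is_delta_gH T f s (fuzzy_scale (sigma T s - s)^-1 w).
Proof.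
move=> d0 iso ss fw e e0; exists d => // t Tt /(iso _ Tt) ->; exists w => //.
by rewrite fuzzy_scaleVK ?subr_eq0// Dinfty_refl mulr_ge0// ltW.
Qed.

Lemma nabla_gH_isolated (R : realType) (T : set R) (f : R -> fuzzy R)
    (s d : R) (w : fuzzy R) :
  0 < d -> (forall t, T t -> s - d < t < s + d -> t = s) ->
  rho T s != s -> is_gH_diff (f s) (f (rho T s)) w ->
  is_nabla_gH T f s (fuzzy_scale (s - rho T s)^-1 w).
Proof.
move=> d0 iso ss fw e e0; exists d => // t Tt /(iso _ Tt) ->; exists w => //.
by rewrite fuzzy_scaleVK ?subr_eq0 1?eq_sym// Dinfty_refl mulr_ge0// ltW.
Qed.

Definition three_points (R : realType) : set R := [set 0; 1; 2].

Lemma time_scale_three_points (R : realType) : time_scale (@three_points R).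
Proof.
split; first by exists 1; left; right.
apply: compact_closed; first exact: Rhausdorff.
by apply: finite_compact; rewrite /three_points; exact: finite_set3.
Qed.

Lemma sigma_three_points (R : realType) : sigma (@three_points R) 1 = 2.
Proof.
rewrite /sigma asboolT; last by exists 2; split; [right|lra].
rewrite (_ : [set _ | _] = [set 2]) ?inf1//; apply/seteqP; split=> x /=.
  by case=> -[[->|->]|->]//; lra.
by move=> ->; split; [right|lra].
Qed.

Lemma rho_three_points (R : realType) : rho (@three_points R) 1 = 0.
Proof.
rewrite /rho asboolT; last by exists 0; split; [left; left|lra].
rewrite (_ : [set _ | _] = [set 0]) ?sup1//; apply/seteqP; split=> x /=.
  by case=> -[[->|->]|->]//; lra.
by move=> ->; split; [left; left|lra].
Qed.

Lemma kappa_both_three_points (R : realType) : kappa_both (@three_points R) 1.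
Proof.
have T1 : @three_points R 1 by left; right.
split; split=> // -[b _].
- by have := b 2 (or_intror erefl); lra.
- by have := b 0 (or_introl (or_introl erefl)); lra.
Qed.

Lemma isolated_three_points (R : realType) (t : R) :
  three_points t -> 1 - 1 < t < 1 + 1 -> t = 1.
Proof. by case=> [[->|->]|->]; lra. Qed.

Theorem theorem4 (R : realType) :
  (exists (T : set R) (f : R -> fuzzy R) (s : R),
     [/\ time_scale T, kappa_both T s,
         (exists L : fuzzy R, is_nabla_gH T f s L) &
         ~ (exists L : fuzzy R, is_delta_gH T f s L)]) /\
  (exists (T : set R) (f : R -> fuzzy R) (s : R),
     [/\ time_scale T, kappa_both T s,
         (exists L : fuzzy R, is_delta_gH T f s L) &
         ~ (exists L : fuzzy R, is_nabla_gH T f s L)]).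
Proof.
have [u [v nuv]] := no_gH_diff_ex R.
have T1 : @three_points R 1 by left; right.
have [n01 n11 n21] : [/\ (0 : R) < 1, ((1 : R) < 1) = false & ((2 : R) < 1) = false].
  by split; [lra|rewrite ltxx|apply/negP; lra].
have [n02 n12 n22] : [/\ (0 : R) < 2, (1 : R) < 2 & ((2 : R) < 2) = false].
  by split; [lra|lra|rewrite ltxx].
split.
- exists (@three_points R), (fun t => if t < 2 then u else v), 1; split.
  + exact: time_scale_three_points.
  + exact: kappa_both_three_points.
  + eexists; apply: (nabla_gH_isolated ltr01 (@isolated_three_points R)).
      by rewrite rho_three_points eq_sym oner_eq0.
    by rewrite rho_three_points n02 n12; exact: gH_diff_self.
  + by move/(delta_gH_diff T1); rewrite sigma_three_points n12 n22.
- exists (@three_points R), (fun t => if t < 1 then u else v), 1; split.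
  + exact: time_scale_three_points.
  + exact: kappa_both_three_points.
  + eexists; apply: (delta_gH_isolated ltr01 (@isolated_three_points R)).
      by rewrite sigma_three_points gt_eqF.
    by rewrite sigma_three_points n11 n21; exact: gH_diff_self.
  + by move/(nabla_gH_diff T1); rewrite rho_three_points n01 n11.
Qed.
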